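(* Let $\mathfrak K_1,\mathfrak K_2,\mathfrak K_3$ be Kreĭn spaces and let the linear relations $T:\mathfrak K_1\to\mathfrak K_2$ and $S:\mathfrak K_2\to\mathfrak K_3$ be isometric. Then: (i) the linear relation $ST:\mathfrak K_1\to\mathfrak K_3$ is isometric. In addition, let $T:\mathfrak K_1\to\mathfrak K_2$ and $S:\mathfrak K_2\to\mathfrak K_3$ be unitary. Then: (ii) if $\operatorname{dom}S$ and $T\,\widehat{+}\,(\{0\}\times\ker S)$ are closed, then $ST:\mathfrak K_1\to\mathfrak K_3$ is unitary; (iii) if $\operatorname{ran}T\subset\operatorname{dom}S$ and $\operatorname{dom}S$ is closed, then $ST$ is unitary and $\operatorname{dom}ST=\operatorname{dom}T$; (iv) if $\operatorname{dom}T$ and $S\,\widehat{+}\,(\operatorname{mul}T\times\{0\})$ are closed, then $ST$ is unitary; (v) if $\operatorname{ran}T\supset\operatorname{dom}S$ and $\operatorname{dom}T$ is closed, then $ST$ is unitary and $\operatorname{ran}ST=\operatorname{ran}S$; (vi) if $\operatorname{ran}T=\operatorname{dom}S$ and $\operatorname{ran}S=\mathfrak K_3$, then the unitary relation $ST:\mathfrak K_1\to\mathfrak K_3$ is bounded and single-valued (not necessarily densely defined); (vii) if $T\in[\mathfrak K_1,\mathfrak K_2]$ or $S\in[\mathfrak K_2,\mathfrak K_3]$, then $ST:\mathfrak K_1\to\mathfrak K_3$ is unitary; (viii) if $T\in[\mathfrak K_1,\mathfrak K_2]$ and $S\in[\mathfrak K_2,\mathfrak K_3]$, then $ST$ is a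 unitary operator which belongs to $[\mathfrak K_1,\mathfrak K_3]$.
   Context: A linear relation $T:\mathfrak K_1\to\mathfrak K_2$ is a linear subspace of $\mathfrak K_1\times\mathfrak K_2$; operators are identified with their graphs. $\operatorname{dom}T,\operatorname{ran}T,\ker T=\{f:\{f,0\}\in T\}$, $\operatorname{mul}T=\{g:\{0,g\}\in T\}$ denote domain, range, kernel and multivalued part, $T^{-1}=\{\{g,f\}:\{f,g\}\in T\}$. The product is $ST=\{\{f,h\}:\{f,g\}\in T,\ \{g,h\}\in S\text{ for some }g\}$. The componentwise sum is $T_1\,\widehat{+}\,T_2=\{\{f+h,g+k\}:\{f,g\}\in T_1,\{h,k\}\in T_2\}$. $[\mathfrak K_1,\mathfrak K_2]$ denotes the bounded everywhere defined linear operators from $\mathfrak K_1$ to $\mathfrak K_2$. A Kreĭn space $(\mathfrak H,j_{\mathfrak H})$ is a Hilbert space $\mathfrak H$ with a signature operator $j_{\mathfrak H}=j_{\mathfrak H}^*=j_{\mathfrak H}^{-1}$ and indefinite inner product $[f,g]=(j_{\mathfrak H}f,g)$; topological notions refer to the Hilbert space. For a linear relation $T$ from $(\mathfrak H,j_{\mathfrak H})$ to $(\mathcal H,j_{\mathcal H})$ the Kreĭn space adjoint is $T^{[*]}=j_{\mathfrak H}T^*j_{\mathcal H}$, i.e. $T^{[*]}=\{\{h,k\}\in\mathcal H\times\mathfrak H:[k,f]_{\mathfrak H}=[h,g]_{\mathcal H}\text{ for all }\{f,g\}\in T\}$. $T$ is isometric if $T^{-1}\subset T^{[*]}$ and unitary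 if $T^{-1}=T^{[*]}$. (A unitary relation may be multivalued, unbounded and nondensely defined.) *)

(* Defs.v *)
From mathcomp Require Import all_boot all_order all_algebra sesquilinear.
From mathcomp Require Import complex.
From mathcomp Require Import all_classical all_reals all_analysis.

Set Implicit Arguments.
Unset Strict Implicit.
Unset Printing Implicit Defensive.

Import Order.TTheory GRing.Theory Num.Theory.
Import numFieldNormedType.Exports.

Local Open Scope classical_set_scope.
Local Open Scope ring_scope.

(** Inner products are linear in the first argument and conjugate-linear in
    the second one. *)
Record hilbertSpace (R : realType) := HilbertSpace {
  hilbert_sort :> completeNormedModType R[i];
  inner : {dot hilbert_sort for Num.conj};
  inner_norm : forall x : hilbert_sort, inner x x = `|x| ^+ 2 }.

(** [signatureV] and [signature_adj] say that j = j^-1 and j = j^*; an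
    everywhere defined j with these properties is automatically bounded. *)
Record kreinSpace (R : realType) := KreinSpace {
  krein_hilbert :> hilbertSpace R;
  signature : {linear krein_hilbert -> krein_hilbert};
  signatureV : forall f, signature (signature f) = f;
  signature_adj : forall f g,
    inner krein_hilbert (signature f) g = inner krein_hilbert f (signature g) }.

Definition krein_form (R : realType) (K : kreinSpace R) (f g : K) : R[i] :=
  inner K (signature K f) g.

Section LinearRelations.
Variable R : realType.
Implicit Types K : kreinSpace R.

Definition linear_relation K1 K2 (T : set (K1 * K2)) : Prop :=
  submod_closed (mem T).

Definition rdom K1 K2 (T : set (K1 * K2)) : set K1 := T.`1.
Definition rran K1 K2 (T : set (K1 * K2)) : set K2 := T.`2.
Definition rker K1 K2 (T : set (K1 * K2)) : set K1 := [set f | T (f, 0)].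
Definition rmul K1 K2 (T : set (K1 * K2)) : set K2 := [set g | T (0, g)].

Definition rinv K1 K2 (T : set (K1 * K2)) : set (K2 * K1) := (T^-1)%relation.

Definition rprod K1 K2 K3 (S : set (K2 * K3)) (T : set (K1 * K2)) :
  set (K1 * K3) := (S \; T)%relation.

Definition rsum K1 K2 (T1 T2 : set (K1 * K2)) : set (K1 * K2) :=
  [set x + y | x in T1 & y in T2].

Definition krein_adjoint K1 K2 (T : set (K1 * K2)) : set (K2 * K1) :=
  [set hk | forall f g, T (f, g) -> krein_form hk.2 f = krein_form hk.1 g].

Definition isometric K1 K2 (T : set (K1 * K2)) : Prop :=
  rinv T `<=` krein_adjoint T.

Definition unitary K1 K2 (T : set (K1 * K2)) : Prop :=
  rinv T = krein_adjoint T.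

Definition single_valued K1 K2 (T : set (K1 * K2)) : Prop :=
  rmul T = [set 0].

Definition bounded_relation K1 K2 (T : set (K1 * K2)) : Prop :=
  exists M : R, forall f g, T (f, g) -> `|g| <= (M%:C)%C * `|f|.

(** The class [K1, K2], its elements being identified with their graphs. *)
Definition bounded_operators K1 K2 : set (set (K1 * K2)) :=
  [set T | (exists A : {linear K1 -> K2}, T = [set fg | fg.2 = A fg.1]) /\
           bounded_relation T].

End LinearRelations.

Arguments bounded_operators {R} K1 K2.

(* Main.v *)
Require Import Defs.
From mathcomp Require Import all_boot all_order all_algebra sesquilinear.
From mathcomp Require Import complex.
From mathcomp Require Import all_classical all_reals all_analysis.
From mathcomp Require Import ring lra.
Import Order.TTheory GRing.Theory Num.Theory.
Import numFieldNormedType.Exports.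
Set Implicit Arguments.
Unset Strict Implicit.
Unset Printing Implicit Defensive.
Local Open Scope classical_set_scope.
Local Open Scope ring_scope.

(** In the graph product K1 * K2 put [(f, g), (h, k)] := [f, h] - [g, k]. A
    linear relation T is isometric iff it is neutral for this form, and unitary
    iff it is Lagrangian, that is equal to its own orthogonal companion.
    Neutrality passes to products at once. That ST is Lagrangian always comes
    from one composition principle, [lagrangian_rprod]: it suffices that dom S
    and T + ({0} x ker S) are closed.

    Proof of the principle. Let (h, k) be orthogonal to ST. First, k is
    orthogonal to mul S, and (mul S)^[perp] = ran S because ran S is closed;
    so (l0, k) is in S for some l0, and (h, l0) is orthogonal to every (f, g) in
    T with g in dom S. Now (ker S)^[perp] = dom S, as dom S is closed, so these
    pairs include the companion of T + ({0} x ker S). Since a closed subspace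
    is its own double companion, (h, l0) lies in T + ({0} x ker S), and
    correcting l0 by an element of ker S gives l with (h, l) in T and (l, k)
    in S.

    That ran S is closed when dom S is ([seq_closed_rran]) comes from the
    estimate [rdom_closed_bound]: for (l, k) in S with j l in dom S one has
    |l| <= C |k|. By the identity [g, l] = [m, k] for (g, m) in S, the vectors
    j l with |k| <= 1 form a weakly bounded set, so the uniform boundedness
    principle ([weakly_bounded]) applies.

    The remaining cases are reductions. If ran T is in dom S then ker S is in
    mul T and the componentwise sum is T itself; the statements with the roles
    of T and S exchanged follow from (ST)^-1 = T^-1 S^-1; a unitary relation
    with full range is an operator, because its multivalued part is orthogonal
    to its range, and it is bounded by the same estimate applied to its
    inverse.

    Subspaces are complex, so orthogonality to them is the same for a form and
    for its real part. The Hilbert space part is therefore carried out with real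
    valued inner products, which are stable under products of spaces. *)

(** * Subspaces *)

Definition subspace {R : realType} {V : lmodType R[i]} (M : set V) : Prop :=
  submod_closed (mem M).

Section Subspaces.
Context {R : realType} {V : lmodType R[i]} {M : set V}.
Hypothesis sM : subspace M.

Lemma subspace0 : M 0.
Proof. by have [/set_mem] := sM. Qed.

Lemma subspaceP a u v : M u -> M v -> M (a *: u + v).
Proof. by move=> Mu Mv; have [_ h] := sM; apply/set_mem/h; apply/mem_set. Qed.

Lemma subspaceZ a u : M u -> M (a *: u).
Proof. by move=> Mu; rewrite -[_ *: _]addr0; apply: subspaceP => //; exact: subspace0. Qed.

Lemma subspaceD u v : M u -> M v -> M (u + v).
Proof. by move=> Mu Mv; rewrite -[u]scale1r; exact: subspaceP. Qed.

Lemma subspaceB u v : M u -> M v -> M (u - v).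
Proof. by move=> Mu Mv; rewrite addrC -scaleN1r; exact: subspaceP. Qed.

End Subspaces.

Lemma subspaceI {R : realType} {V : lmodType R[i]} (M : set V) :
  M 0 -> (forall a u v, M u -> M v -> M (a *: u + v)) -> subspace M.
Proof.
move=> M0 MP; split; first exact/mem_set.
by move=> a u v /set_mem Mu /set_mem Mv; apply/mem_set/MP.
Qed.

(** * Real inner products *)

(** The real part of a Hilbert space inner product, as a structure on the
    complex vector space itself: only real scalars can be pulled out. The sum of
    two such forms is one on the product space, whose norm need not be the
    maximum norm carried by that product. *)
Record real_inner (R : realType) (V : lmodType R[i]) := RealInner {
  rip :> V -> V -> R;
  ripC : forall x y, rip x y = rip y x;
  ripDl : forall x y z, rip (x + y) z = rip x z + rip y z;
  ripZl : forall a x y, rip (a%:C%C *: x) y = a * rip x y;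
  rip_gt0 : forall x, x != 0 -> 0 < rip x x }.

Section RealInner.
Context {R : realType} {V : lmodType R[i]} (ip : real_inner V).

Lemma ripDr x y z : ip z (x + y) = ip z x + ip z y.
Proof. by rewrite ripC ripDl !(ripC ip z). Qed.
Lemma ripZr a x y : ip x (a%:C%C *: y) = a * ip x y.
Proof. by rewrite ripC ripZl (ripC ip x). Qed.
Lemma ripNl x y : ip (- x) y = - ip x y.
Proof. by rewrite -scaleN1r -(rmorphN1 (real_complex R)) ripZl mulN1r. Qed.
Lemma ripNr x y : ip x (- y) = - ip x y.
Proof. by rewrite ripC ripNl (ripC ip x). Qed.
Lemma ripBl x y z : ip (x - y) z = ip x z - ip y z.
Proof. by rewrite ripDl ripNl. Qed.
Lemma ripBr x y z : ip z (x - y) = ip z x - ip z y.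
Proof. by rewrite ripDr ripNr. Qed.
Lemma rip0l y : ip 0 y = 0.
Proof. by rewrite -(subrr y) ripBl subrr. Qed.
Lemma rip0r y : ip y 0 = 0.
Proof. by rewrite ripC rip0l. Qed.
Lemma rip_ge0 x : 0 <= ip x x.
Proof. by have [->|/(rip_gt0 ip)/ltW] := eqVneq x 0; rewrite ?rip0l. Qed.

Lemma rip_eq0 x : ip x x = 0 -> x = 0.
Proof.
by move=> xx0; apply/eqP/negP => /negP/(rip_gt0 ip); rewrite xx0 ltxx.
Qed.

Definition rnorm x : R := Num.sqrt (ip x x).

Lemma rnorm_ge0 x : 0 <= rnorm x. Proof. exact: sqrtr_ge0. Qed.

Lemma sqr_rnorm x : rnorm x ^+ 2 = ip x x.
Proof. by rewrite sqr_sqrtr// rip_ge0. Qed.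

Lemma rnormN x : rnorm (- x) = rnorm x.
Proof. by rewrite /rnorm ripNl ripNr opprK. Qed.

Lemma rnormB x y : rnorm (x - y) = rnorm (y - x).
Proof. by rewrite -opprB rnormN. Qed.

Lemma rnormZ a x : rnorm (a%:C%C *: x) = `|a| * rnorm x.
Proof. by rewrite /rnorm ripZl ripZr mulrA -expr2 sqrtrM ?sqr_ge0// sqrtr_sqr. Qed.

(** Positivity of the form at (y, y) x - (x, y) y. *)
Lemma cauchy_schwarz x y : `|ip x y| <= rnorm x * rnorm y.
Proof.
rewrite -(@ler_pXn2r _ 2)// ?nnegrE ?mulr_ge0 ?rnorm_ge0//.
rewrite real_normK ?num_real// exprMn !sqr_rnorm.
have [->|y0] := eqVneq y 0; first by rewrite !rip0r expr0n mulr0.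
have yy := rip_gt0 ip y0.
have := rip_ge0 ((ip y y)%:C%C *: x - (ip x y)%:C%C *: y).
rewrite !(ripBl, ripBr, ripZl, ripZr) (ripC ip y x).
rewrite (_ : _ - _ = ip y y * (ip x x * ip y y - ip x y ^+ 2)); last by ring.
by rewrite pmulr_rge0// subr_ge0.
Qed.

Lemma rnormD x y : rnorm (x + y) <= rnorm x + rnorm y.
Proof.
rewrite -(@ler_pXn2r _ 2)// ?nnegrE ?addr_ge0 ?rnorm_ge0//.
have := le_trans (ler_norm _) (cauchy_schwarz x y).
rewrite sqrrD !sqr_rnorm !(ripDl, ripDr) (ripC ip y x); lra.
Qed.

Lemma rnorm_triangle z x y : rnorm (x - y) <= rnorm (x - z) + rnorm (z - y).
Proof. by rewrite -{1}(subrK z x) -addrA rnormD. Qed.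

(** Convergence is with respect to [rnorm], since a space with a real inner
    product carries no topology by itself. *)
Definition seq_limit (u : nat -> V) (l : V) : Prop :=
  forall e, 0 < e -> exists N, forall n, (N <= n)%N -> rnorm (u n - l) < e.

Definition seq_cauchy (u : nat -> V) : Prop :=
  forall e, 0 < e -> exists N, forall m n, (N <= m)%N -> (N <= n)%N ->
    rnorm (u m - u n) < e.

Definition seq_complete : Prop :=
  forall u, seq_cauchy u -> exists l, seq_limit u l.

Definition seq_closed (M : set V) : Prop :=
  forall u l, (forall n, M (u n)) -> seq_limit u l -> M l.

Definition rortho (M : set V) : set V :=
  [set x | forall y, M y -> ip x y = 0].

Lemma seq_limit_cauchy u l : seq_limit u l -> seq_cauchy u.
Proof.
move=> ul e e0; have e2 : 0 < e / 2 by rewrite divr_gt0.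
have [N HN] := ul _ e2; exists N => m n mN nN.
apply: le_lt_trans (rnorm_triangle l _ _) _.
by rewrite (splitr e) ltrD// ?HN// rnormB HN.
Qed.

Lemma seq_closed_ortho M : seq_closed (rortho M).
Proof.
move=> u l Mu ul y My; apply/eqP; rewrite -normr_le0; apply/ler_addgt0Pr => e e0.
have d0 : 0 < e / (rnorm y + 1).
  by rewrite divr_gt0// ltr_wpDl// rnorm_ge0.
have [N /(_ N (leqnn N)) HN] := ul _ d0.
have -> : ip l y = - ip (u N - l) y by rewrite ripBl Mu// sub0r opprK.
rewrite add0r normrN; apply: le_trans (cauchy_schwarz _ _) _.
rewrite -(@ler_pM2r _ ((rnorm y + 1)^-1)) ?invr_gt0; last first.
  by rewrite ltr_wpDl// rnorm_ge0.
apply: le_trans (ltW HN); rewrite -mulrA ler_piMr// ?rnorm_ge0//.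
by rewrite ler_pdivrMr ?mul1r ?lerDl// ltr_wpDl// rnorm_ge0.
Qed.

Hypothesis complete : seq_complete.

(** A minimizing sequence for the distance from x to M is Cauchy by the
    parallelogram law, and its limit p is a nearest point; moving p along y in M
    cannot decrease the distance, which makes x - p orthogonal to y. *)
Lemma ortho_projection M : subspace M -> seq_closed M ->
  forall x, exists2 p, M p & rortho M (x - p).
Proof.
move=> sM cM x.
pose D := [set r | exists2 m, M m & r = ip (x - m) (x - m)].
have D0 : lbound D 0 by move=> _ [m _ ->]; exact: rip_ge0.
have hD : has_inf D.
  by split; [exists (ip (x - 0) (x - 0)), 0 => //; exact: subspace0 | exists 0].
set d := inf D.
have dD m : M m -> d <= ip (x - m) (x - m).
  by move=> Mm; apply: ge_inf; [case: hD | exists m].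
have apx n : exists m, M m /\ ip (x - m) (x - m) < d + n.+1%:R^-1.
  have [|_ [m Mm ->] ?] := inf_adherent (_ : 0 < n.+1%:R^-1) hD.
    by rewrite invr_gt0.
  by exists m.
have [m Hm] := choice apx.
have Mm n : M (m n) by have [] := Hm n.
(* Parallelogram law at x - m a and x - m b, whose half sum is x minus a point
   of M. *)
have cm a b : ip (m a - m b) (m a - m b) <= 2 * (a.+1%:R^-1 + b.+1%:R^-1).
  have := dD _ (subspaceZ sM (2^-1)%:C%C (subspaceD sM (Mm a) (Mm b))).
  have := proj2 (Hm a); have := proj2 (Hm b).
  rewrite !(ripDl, ripDr, ripNl, ripNr, ripZl, ripZr, ripDl, ripDr).
  rewrite (ripC ip (m a) x) (ripC ip (m b) x) (ripC ip (m b) (m a)).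
  move: (a.+1%:R^-1) (b.+1%:R^-1) => ea eb. lra.
have small (e : R) : 0 < e -> exists N, forall n, (N <= n)%N -> n.+1%:R^-1 < e :> R.
  move=> e0; have [N _ HN] := near_infty_natSinv_lt (PosNum e0).
  by exists N => n /HN.
have [|p mp] := complete (u := m).
  move=> e e0; have [N HN] := small (e ^+ 2 / 4) ltac:(by rewrite divr_gt0// exprn_gt0).
  exists N => a b /HN Na /HN Nb.
  rewrite -(@ltr_pXn2r _ 2)// ?nnegrE ?rnorm_ge0 ?(ltW e0)// sqr_rnorm.
  apply: le_lt_trans (cm a b) _; move: Na Nb.
  by move: (a.+1%:R^-1) (b.+1%:R^-1) => ea eb; lra.
have Mp : M p by exact: cM mp.
have dp : ip (x - p) (x - p) <= d.
  rewrite -sqr_rnorm.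
  have d0 : 0 <= d by apply: lb_le_inf => //; case: hD.
  rewrite -(sqr_sqrtr d0) ler_pXn2r ?nnegrE ?rnorm_ge0 ?sqrtr_ge0//.
  apply/ler_addgt0Pr => e e0.
  have e2 : 0 < e / 2 by rewrite divr_gt0.
  have [N1 H1] := mp _ e2.
  have [N2 H2] := small ((e / 2) ^+ 2) (exprn_gt0 _ e2).
  set N := maxn N1 N2.
  apply: le_trans (rnorm_triangle (m N) _ _) _.
  have h1 := H1 N (leq_maxl _ _); have h2 := H2 N (leq_maxr _ _).
  suff : rnorm (x - m N) <= Num.sqrt d + e / 2 by lra.
  rewrite -(@ler_pXn2r _ 2)// ?nnegrE ?rnorm_ge0 ?addr_ge0 ?sqrtr_ge0 ?(ltW e2)//.
  rewrite sqr_rnorm sqrrD sqr_sqrtr//.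
  have := proj2 (Hm N); move: (N.+1%:R^-1) h2 => eN h2.
  have : 0 <= Num.sqrt d * (e / 2) by rewrite mulr_ge0// ?sqrtr_ge0// ltW.
  lra.
exists p => // y My; have [->|y0] := eqVneq y 0; first by rewrite rip0r.
have yy := rip_gt0 ip y0.
(* p + t y is the point of the line p + R y nearest to x. *)
set t := ip (x - p) y / ip y y.
have := le_trans dp (dD _ (subspaceD sM Mp (subspaceZ sM t%:C%C My))).
rewrite opprD addrA ![ip (x - p - _) _]ripBl ![ip _ (x - p - _)]ripBr !(ripZl,ripZr).
rewrite (ripC ip y (x - p)).
have tE : ip (x - p) y = t * ip y y by rewrite /t divfK// gt_eqF.
rewrite tE => h.
have t2 : t ^+ 2 * ip y y <= 0 by nra.
have : t ^+ 2 <= 0 by rewrite -(pmulr_lle0 _ yy).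
by rewrite real_exprn_even_le0 ?num_real//= => /eqP ->; rewrite mul0r.
Qed.

Lemma ortho_ortho M : subspace M -> seq_closed M -> rortho (rortho M) `<=` M.
Proof.
move=> sM cM x Hx; have [p Mp px] := ortho_projection sM cM x.
suff /rip_eq0/eqP : ip (x - p) (x - p) = 0 by rewrite subr_eq0 => /eqP ->.
by rewrite ripBl Hx// (ripC ip p) px// subrr.
Qed.

(** Uniform boundedness principle for the functionals (-, y), y in A. Either
    they are bounded by a common n on some ball, which bounds A by 2n / radius,
    or there are nested balls, the n-th of which carries a functional exceeding
    n; a common point of these balls contradicts weak boundedness. *)
Lemma weakly_bounded (A : set V) :
  (forall x, exists B : R, forall y, A y -> `|ip x y| <= B) ->
  exists C : R, forall y, A y -> rnorm y <= C.
Proof.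
move=> wb.
suff [x [r [n [r0 H]]]] : exists (x : V) (r n : R), 0 < r /\
    forall z y, rnorm (z - x) <= r -> A y -> `|ip z y| <= n.
  exists (2 * n / r) => y Ay; rewrite ler_pdivlMr//.
  have [y0|y0] := leP (rnorm y) 0.
    have : `|ip x y| <= n by apply: H => //; rewrite subrr /rnorm rip0l sqrtr0 ltW.
    move=> /(le_trans (normr_ge0 _)) n0.
    apply: (@le_trans _ _ 0); first by rewrite mulr_le0_ge0// ltW.
    by rewrite mulr_ge0.
  pose z := x + (r / rnorm y)%:C%C *: y.
  have hz : `|ip z y| <= n.
    apply: H => //; rewrite /z addrC addKr rnormZ ger0_norm; last first.
      by rewrite divr_ge0// ltW.
    by rewrite divfK// gt_eqF.
  have hx : `|ip x y| <= n by apply: H => //; rewrite subrr /rnorm rip0l sqrtr0 ltW.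
  have -> : rnorm y * r = ip z y - ip x y.
    rewrite /z ripDl ripZl -sqr_rnorm addrC addKr expr2 mulrA divfK ?gt_eqF//.
    by rewrite mulrC.
  apply: le_trans (ler_norm _) _; apply: le_trans (ler_normB _ _) _; lra.
apply: contrapT => Hn.
(* A pair s stands for the closed ball with centre s.1 and radius s.2. *)
have step (s : V * R) (n : nat) : exists s' : V * R, 0 < s.2 ->
    [/\ 0 < s'.2, s'.2 <= s.2 / 2, rnorm (s'.1 - s.1) <= s.2 / 2
     & exists2 y, A y & forall z, rnorm (z - s'.1) <= s'.2 -> n%:R < `|ip z y|].
  case: s => x r; have [r0|r0] := leP r 0; first by exists (x, r); rewrite ltNge r0.
  have r2 : 0 < r / 2 by rewrite divr_gt0.
  have [z [y [zx Ay zy]]] : exists z y,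
      [/\ rnorm (z - x) <= r / 2, A y & n%:R < `|ip z y|].
    apply: contrapT => Hzy; apply: Hn; exists x, (r / 2), n%:R; split=> // z y zx Ay.
    by rewrite leNgt; apply/negP => ?; apply: Hzy; exists z, y.
  (* With radius c, (-, y) varies by less than its excess over n at z. *)
  pose c := (`|ip z y| - n%:R) / (2 * (rnorm y + 1)).
  have y1 : 0 < rnorm y + 1 by rewrite ltr_wpDl// rnorm_ge0.
  have c0 : 0 < c by rewrite divr_gt0 ?subr_gt0// mulr_gt0.
  exists (z, Num.min (r / 2) c) => _ /=; split => //.
  - by rewrite lt_min r2.
  - by rewrite ge_min lexx.
  exists y => // w; rewrite le_min => /andP[_ wz].
  have h1 : `|ip (w - z) y| <= c * rnorm y.
    by apply: le_trans (cauchy_schwarz _ _) _; rewrite ler_wpM2r// rnorm_ge0.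
  have h2 : `|ip z y| <= `|ip w y| + `|ip (w - z) y|.
    rewrite -[in leLHS](subKr w z) ripBl; exact: ler_normB.
  have h3 : c * (2 * (rnorm y + 1)) = `|ip z y| - n%:R.
    by rewrite /c divfK// mulf_neq0 ?gt_eqF.
  have h4 := rnorm_ge0 y; nra.
have [f Hf] := choice (fun sn : (V * R) * nat => step sn.1 sn.2).
pose s := fix s n := if n is n'.+1 then f (s n', n') else (0 : V, 1 : R).
have s0 n : 0 < (s n).2.
  by elim: n => [|n IH] //=; have [] := Hf (s n, n) IH.
have sS n := Hf (s n, n) (s0 n).
have sr n : (s n).2 <= 2^-1 ^+ n.
  elim: n => [|n IH]; first by rewrite expr0.
  have [_ + _ _] := sS n => /le_trans; apply.
  by rewrite exprSr /= ler_wpM2r.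
(* Sharper than membership in the n-th ball, so that it survives induction. *)
have nest n k : rnorm ((s (n + k)%N).1 - (s n).1) <= (s n).2 - (s (n + k)%N).2.
  elim: k => [|k IH]; first by rewrite addn0 !subrr /rnorm rip0l sqrtr0.
  rewrite addnS; apply: le_trans (rnorm_triangle (s (n + k)%N).1 _ _) _.
  have [/= _ h1 h2 _] := sS (n + k)%N; lra.
have nestle n m : (n <= m)%N -> rnorm ((s m).1 - (s n).1) <= (s n).2.
  by move=> /subnKC <-; apply: le_trans (nest _ _) _; rewrite gerBl ltW.
have [|l sl] := complete (u := fun n => (s n).1).
  move=> e e0; have [N _ HN] : \forall n \near \oo, (2^-1 ^+ n : R) < e / 2.
    have /cvgrPdist_lt/(_ (e / 2)) : (fun n => 2^-1 ^+ n : R) @ \oo --> (0:R).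
      by apply: cvg_expr; rewrite ger0_norm// invf_lt1// ltr1n.
    rewrite divr_gt0// => /(_ isT); apply: filterS => n /=.
    by rewrite sub0r normrN ger0_norm// exprn_ge0.
  exists N => m n Nm Nn; apply: le_lt_trans (rnorm_triangle (s N).1 _ _) _.
  rewrite (rnormB _ (s n).1).
  have := nestle _ _ Nm; have := nestle _ _ Nn; have := sr N.
  have /= := HN N (leqnn N); lra.
have ls n : rnorm (l - (s n).1) <= (s n).2.
  apply/ler_addgt0Pr => e e0; have [N HN] := sl _ e0.
  apply: le_trans (rnorm_triangle (s (maxn n N)).1 _ _) _.
  have := HN _ (leq_maxr n N); have := nestle _ _ (leq_maxl n N).
  rewrite (rnormB l); lra.
have [B HB] := wb l.
have [_ _ _ [y Ay /(_ _ (ls (Num.bound `|B|).+1))]] := sS (Num.bound `|B|).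
rewrite ltNge (le_trans (HB _ Ay))// (le_trans (ler_norm _))// ltW//.
exact: archi_boundP.
Qed.

End RealInner.

(** * Products and Hilbert spaces *)

Lemma rip_sumr_gt0 (R : realType) (V W : lmodType R[i])
    (p : real_inner V) (q : real_inner W) (x : V * W) :
  x != 0 -> 0 < p x.1 x.1 + q x.2 x.2.
Proof.
case: x => a b; have [->|a0 _] := eqVneq a 0; last first.
  by rewrite ltr_pwDl ?rip_gt0 ?rip_ge0.
by rewrite xpair_eqE eqxx /= => b0; rewrite rip0l add0r rip_gt0.
Qed.

Definition prod_inner (R : realType) (V W : lmodType R[i])
  (p : real_inner V) (q : real_inner W) : real_inner (V * W)%type.
Proof.
refine (@RealInner _ (V * W)%type
  (fun x y => p x.1 y.1 + q x.2 y.2) _ _ _ (@rip_sumr_gt0 _ _ _ p q)).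
- by move=> x y; rewrite (ripC p) (ripC q).
- by move=> x y z /=; rewrite !ripDl addrACA.
- by move=> a x y /=; rewrite !ripZl mulrDr.
Defined.

Section ProdInner.
Context {R : realType} {V W : lmodType R[i]}.
Variables (p : real_inner V) (q : real_inner W).
Local Notation pq := (prod_inner p q).

Lemma rnorm_fst x : rnorm p x.1 <= rnorm pq x.
Proof. by rewrite ler_wsqrtr//= lerDl rip_ge0. Qed.

Lemma rnorm_snd x : rnorm q x.2 <= rnorm pq x.
Proof. by rewrite ler_wsqrtr//= lerDr rip_ge0. Qed.

Lemma rnorm_pair x : rnorm pq x <= rnorm p x.1 + rnorm q x.2.
Proof.
rewrite -(@ler_pXn2r _ 2)// ?nnegrE ?addr_ge0 ?rnorm_ge0//.
rewrite sqrrD !sqr_rnorm /= addrAC lerDl mulrn_wge0// mulr_ge0//; exact: rnorm_ge0.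
Qed.

Lemma seq_limit_pair u v a b : seq_limit p u a -> seq_limit q v b ->
  seq_limit pq (fun n => (u n, v n)) (a, b).
Proof.
move=> ua vb e e0; have e2 : 0 < e / 2 by rewrite divr_gt0.
have [N HN] := ua _ e2; have [N' HN'] := vb _ e2.
exists (maxn N N') => n; rewrite geq_max => /andP[nN nN'].
apply: le_lt_trans (rnorm_pair _) _.
by rewrite (splitr e) ltrD//= ?HN ?HN'.
Qed.

Lemma seq_complete_prod : seq_complete p -> seq_complete q -> seq_complete pq.
Proof.
move=> cp cq u cu.
have [|a ua] := cp (fun n => (u n).1).
  move=> e /cu[N HN]; exists N => m n mN nN.
  exact: le_lt_trans (rnorm_fst (u m - u n)) (HN _ _ mN nN).
have [|b ub] := cq (fun n => (u n).2).
  move=> e /cu[N HN]; exists N => m n mN nN.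
  exact: le_lt_trans (rnorm_snd (u m - u n)) (HN _ _ mN nN).
exists (a, b); have := seq_limit_pair ua ub.
by under eq_fun do rewrite -surjective_pairing.
Qed.

Lemma seq_limit_fst u l :
  seq_limit pq u l -> seq_limit p (fun n => (u n).1) l.1.
Proof.
move=> ul e /ul[N HN]; exists N => n /HN; apply: le_lt_trans.
exact: (rnorm_fst (u n - l)).
Qed.

Lemma seq_limit_snd u l :
  seq_limit pq u l -> seq_limit q (fun n => (u n).2) l.2.
Proof.
move=> ul e /ul[N HN]; exists N => n /HN; apply: le_lt_trans.
exact: (rnorm_snd (u n - l)).
Qed.

End ProdInner.

Section HilbertInner.
Context {R : realType} (H : hilbertSpace R).

Lemma innerC (x y : H) : inner H x y = (inner H y x)^*%C.
Proof. by rewrite (hermC (inner H)) expr0 mul1r. Qed.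

Lemma inner_self_ge0 (x : H) : 0 <= inner H x x.
Proof. by rewrite inner_norm exprn_ge0. Qed.

Definition hilbert_inner : real_inner H.
Proof.
refine (@RealInner _ H (fun x y => complex.Re (inner H x y)) _ _ _ _).
- by move=> x y; rewrite innerC; case: (inner H y x).
- by move=> x y z; rewrite linearDl raddfD.
- by move=> a x y; rewrite linearZl_LR /=; case: (inner H x y) => b c /=; rewrite mul0r subr0.
- move=> x /(neq0_dnorm_gt0 (s := inner H)).
  by rewrite ltcE /= => /andP[].
Defined.

(** The norm of a Hilbert space takes its values in the complex numbers. *)
Lemma normE (x : H) : `|x| = (rnorm hilbert_inner x)%:C%C.
Proof.
apply/eqP; rewrite -(@eqrXn2 _ 2)// ?ler0c ?rnorm_ge0//.
rewrite -rmorphXn /= sqr_rnorm -inner_norm /=.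
by have := inner_self_ge0 x; case: (inner H x x) => a b; rewrite lecE /= => /andP[/eqP -> _].
Qed.

Lemma seq_limit_cvg (u : nat -> H) (l : H) :
  seq_limit hilbert_inner u l -> u @ \oo --> l.
Proof.
move=> ul; apply/cvgrPdist_lt => e e0.
have := e0; rewrite ltcE /= => /andP[/eqP e1 e2].
have [N HN] := ul _ e2; exists N => //= n /HN.
rewrite rnormB normE -ltcR => h; apply: lt_le_trans h _.
by rewrite lecE /= e1 eqxx lexx.
Qed.

Lemma cvg_seq_limit (u : nat -> H) (l : H) :
  u @ \oo --> l -> seq_limit hilbert_inner u l.
Proof.
move=> /cvgrPdist_lt ul e e0.
have [|N _ HN] := ul e%:C%C; first by rewrite ltcR.
by exists N => n /HN /=; rewrite normE ltcR rnormB.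
Qed.

Lemma hilbert_complete : seq_complete hilbert_inner.
Proof.
move=> u cu; suff /cvg_ex[l /cvg_seq_limit ul] : cvg (u @ \oo) by exists l.
apply: cauchy_cvg; apply: cauchy_exP => e e0.
have := e0; rewrite ltcE /= => /andP[/eqP e1 e2].
have [N HN] := cu _ e2; exists (u N), N => // n /= Nn.
rewrite -ball_normE /=; have := HN _ _ (leqnn N) Nn.
rewrite normE -ltcR => h; apply: lt_le_trans h _.
by rewrite lecE /= e1 eqxx lexx.
Qed.

Lemma closed_seq_closed (A : set H) : closed A -> seq_closed hilbert_inner A.
Proof.
move=> cA u l uA /seq_limit_cvg ul.
by apply: (@closed_cvg _ _ _ _ u A cA _ l ul); exact: nearW.
Qed.

End HilbertInner.

Lemma closed_seq_closed2 (R : realType) (H1 H2 : hilbertSpace R) (A : set (H1 * H2)) :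
  closed A -> seq_closed (prod_inner (hilbert_inner H1) (hilbert_inner H2)) A.
Proof.
move=> cA u l uA ul; apply: (@closed_cvg _ _ \oo _ u A cA _ l _).
  exact: nearW.
case: l ul => a b ul.
have := cvg_pair (seq_limit_cvg (seq_limit_fst ul)) (seq_limit_cvg (seq_limit_snd ul)).
move=> h; apply: cvg_trans (h _ _ _) => /=.
by under eq_fun do rewrite -surjective_pairing.
Qed.

(** * The real part of the indefinite inner product *)

Section KreinForm.
Context {R : realType} {K : kreinSpace R}.
Local Notation ip := (hilbert_inner K).
Local Notation j := (signature K).

Definition real_form (f g : K) : R := ip (j f) g.

Lemma real_formE f g : real_form f g = complex.Re (krein_form f g).
Proof. by []. Qed.

Lemma real_form_adj f g : real_form f g = ip f (j g).
Proof. by rewrite /real_form /= signature_adj. Qed.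

Lemma real_formC f g : real_form f g = real_form g f.
Proof. by rewrite real_form_adj ripC. Qed.

Lemma real_form0 h : real_form 0 h = 0.
Proof. by rewrite /real_form linear0 rip0l. Qed.

Lemma real_form_signature f g : real_form f (j g) = ip f g.
Proof. by rewrite real_form_adj signatureV. Qed.

Lemma signature_ip f g : ip (j f) (j g) = ip f g.
Proof. by rewrite -[LHS]real_form_adj real_formC real_form_signature ripC. Qed.

Lemma rnorm_signature f : rnorm ip (j f) = rnorm ip f.
Proof. by rewrite /rnorm signature_ip. Qed.

Lemma real_form_bound f g : `|real_form f g| <= rnorm ip f * rnorm ip g.
Proof. by rewrite -(rnorm_signature f); exact: cauchy_schwarz. Qed.

Lemma krein_formZr (a : R[i]) (f g : K) :
  krein_form f (a *: g) = a^*%C * krein_form f g.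
Proof. by rewrite /krein_form linearZr_LR. Qed.

End KreinForm.

(** * Linear relations *)

Section Relations.
Context {R : realType}.
Implicit Types K : kreinSpace R.

(** Unitarity as self-orthogonality of the graph; unlike [unitary] it is
    visibly invariant under inversion and does not involve complex scalars. *)
Definition lagrangian {K1 K2} (T : set (K1 * K2)) : Prop :=
  forall h k, T (h, k) <->
    forall f g, T (f, g) -> real_form h f = real_form k g.

Lemma linear_relationI {K1 K2} (T : set (K1 * K2)) : T (0, 0) ->
  (forall a f g h k, T (f, g) -> T (h, k) -> T (a *: f + h, a *: g + k)) ->
  linear_relation T.
Proof.
by move=> T0 TP; apply: subspaceI => // a [f g] [h k]; exact: TP.
Qed.

Lemma linear_relation0 {K1 K2} {T : set (K1 * K2)} :
  linear_relation T -> T (0, 0).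
Proof. by move=> linT; exact: (subspace0 linT). Qed.

Lemma linear_relationP {K1 K2} {T : set (K1 * K2)} a {f g h k} :
  linear_relation T -> T (f, g) -> T (h, k) -> T (a *: f + h, a *: g + k).
Proof. by move=> linT Tfg Thk; exact: (subspaceP linT a Tfg Thk). Qed.

Lemma linear_relationZ {K1 K2} {T : set (K1 * K2)} a {f g} :
  linear_relation T -> T (f, g) -> T (a *: f, a *: g).
Proof. by move=> linT Tfg; exact: (subspaceZ linT a Tfg). Qed.

Lemma linear_relationB {K1 K2} {T : set (K1 * K2)} {f g h k} :
  linear_relation T -> T (f, g) -> T (h, k) -> T (f - h, g - k).
Proof. by move=> linT Tfg Thk; exact: (subspaceB linT Tfg Thk). Qed.

Lemma lagrangian_real {K1 K2} (T : set (K1 * K2)) f g h k :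
  lagrangian T -> T (f, g) -> T (h, k) -> real_form f h = real_form g k.
Proof. by move=> LT Tfg Thk; exact: (LT f g).1. Qed.

(** A relation contains (i f, i g) along with (f, g), so the imaginary parts of
    the two forms agree on it as soon as the real parts do. *)
Lemma unitaryE {K1 K2} (T : set (K1 * K2)) :
  linear_relation T -> unitary T <-> lagrangian T.
Proof.
move=> linT.
have adjE h k : krein_adjoint T (k, h) <->
    forall f g, T (f, g) -> real_form h f = real_form k g.
  split=> [+ f g Tfg|H f g Tfg] /=.
    by move=> /(_ f g Tfg) /= hk; rewrite !real_formE hk.
  have := H _ _ Tfg; rewrite !real_formE => Hre.
  have := H _ _ (linear_relationZ 'i%C linT Tfg); rewrite !real_formE !krein_formZr.
  move: Hre; case: (krein_form h f) => a b; case: (krein_form k g) => c d /= ->.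
  by rewrite !mul0r !sub0r !mulN1r !opprK => ->.
split=> [uT h k|LT].
  by rewrite -adjE -uT.
apply/seteqP; split=> -[k h] /=; first by move=> /LT /adjE.
by move=> /adjE /LT.
Qed.

Lemma lagrangian_inv {K1 K2} (T : set (K1 * K2)) :
  lagrangian T -> lagrangian (rinv T).
Proof.
by move=> LT k h; split=> [/LT H g f /H ->//|H]; apply/LT => f g /H ->.
Qed.

Lemma linear_rinv {K1 K2} (T : set (K1 * K2)) :
  linear_relation T -> linear_relation (rinv T).
Proof.
move=> linT; apply: linear_relationI; first exact: (linear_relation0 linT).
move=> a f g h k Tu Tv; exact: (linear_relationP a linT Tu Tv).
Qed.

Lemma linear_rdom {K1 K2} (T : set (K1 * K2)) :
  linear_relation T -> subspace (rdom T).
Proof.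
move=> linT; apply: subspaceI; first by exists 0; exact: linear_relation0.
move=> a f h [g Tfg] [k Thk]; exists (a *: g + k).
exact: linear_relationP.
Qed.

Lemma linear_rprod {K1 K2 K3} (S : set (K2 * K3)) (T : set (K1 * K2)) :
  linear_relation S -> linear_relation T -> linear_relation (rprod S T).
Proof.
move=> linS linT; apply: linear_relationI.
  by exists 0; exact: linear_relation0.
move=> a f h f' h' [g Tfg Sgh] [g' Tfg' Sgh'].
by exists (a *: g + g'); exact: linear_relationP.
Qed.

Lemma linear_rsum {K1 K2} (T1 T2 : set (K1 * K2)) :
  linear_relation T1 -> linear_relation T2 -> linear_relation (rsum T1 T2).
Proof.
move=> lin1 lin2; apply: subspaceI.
  exists 0; first exact: (subspace0 lin1).
  by exists 0; [exact: (subspace0 lin2) | rewrite addr0].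
move=> a _ _ [x Tx [y Ty <-]] [x' Tx' [y' Ty' <-]].
exists (a *: x + x'); first exact: (subspaceP lin1 a Tx Tx').
exists (a *: y + y'); first exact: (subspaceP lin2 a Ty Ty').
by rewrite scalerDr addrACA.
Qed.

Lemma isometric_rprod {K1 K2 K3} (S : set (K2 * K3)) (T : set (K1 * K2)) :
  isometric S -> isometric T -> isometric (rprod S T).
Proof.
move=> iS iT [h f] [g Tfg Sgh] f' h' [g' Tfg' Sgh'] /=.
by rewrite (iT (g, f) Tfg _ _ Tfg') (iS (h, g) Sgh _ _ Sgh').
Qed.

Lemma rinv_rprod {K1 K2 K3} (S : set (K2 * K3)) (T : set (K1 * K2)) :
  rinv (rprod S T) = rprod (rinv T) (rinv S).
Proof. by apply/seteqP; split=> -[h f] [g ? ?]; exists g. Qed.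

(** * Lagrangian relations with closed domain *)

Section Lagrangian.
Context {K1 K2 : kreinSpace R} {T : set (K1 * K2)}.
Hypotheses (linT : linear_relation T) (LT : lagrangian T).
Local Notation ip1 := (hilbert_inner K1).
Local Notation ip2 := (hilbert_inner K2).

Lemma rker_perp h : T (h, 0) <-> forall f, rdom T f -> real_form h f = 0.
Proof.
split=> [Th f [g Tfg]|H]; first by rewrite (lagrangian_real LT Th Tfg) real_form0.
by apply/LT => f g Tfg; rewrite real_form0; apply: H; exists g.
Qed.

(** The image of T under (j, - j) has T as its orthogonal complement, and
    orthogonal complements are closed. *)
Lemma lagrangian_seq_closed : seq_closed (prod_inner ip1 ip2) T.
Proof.
pose A := [set x : K1 * K2 |
  exists f g, T (f, g) /\ x = (signature K1 f, - signature K2 g)].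
suff -> : T = rortho (prod_inner ip1 ip2) A by exact: seq_closed_ortho.
apply/seteqP; split=> -[h k].
  move=> Thk _ [f [g [Tfg ->]]] /=; rewrite -!/(ip1 _ _) -!/(ip2 _ _).
  have := lagrangian_real LT Thk Tfg; rewrite !real_form_adj => /= ->.
  by rewrite linearNr raddfN subrr.
move=> H; apply/LT => f g Tfg.
have /(H _) : A (signature K1 f, - signature K2 g) by exists f, g.
move=> /eqP; rewrite !real_form_adj /= linearNr raddfN subr_eq0.
by move=> /eqP.
Qed.

Hypothesis cdom : seq_closed ip1 (rdom T).

(** The double orthogonal of the closed subspace dom T, the orthogonal
    companion of dom T being ker T. *)
Lemma rdom_perp_rker f :
  (forall h, T (h, 0) -> real_form h f = 0) -> rdom T f.
Proof.
move=> H; apply: (ortho_ortho (@hilbert_complete R K1) (linear_rdom linT) cdom).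
move=> w wdom; rewrite ripC -[w]signatureV; apply: H; apply/rker_perp => g Tg.
by rewrite /real_form signatureV; exact: wdom.
Qed.

(** Normalizes the first component modulo ker T: projecting j l on dom T
    changes l by an element of j (dom T)^perp = ker T. *)
Lemma rker_reduction l k : T (l, k) ->
  exists2 l', T (l', k) & rdom T (signature K1 l').
Proof.
move=> Tlk; have [p dp lp] := ortho_projection (@hilbert_complete R K1)
  (linear_rdom linT) cdom (signature K1 l).
exists (signature K1 p); last by rewrite signatureV.
have : T (l - signature K1 p, 0).
  apply/rker_perp => f df.
  by rewrite /real_form linearB signatureV; exact: lp.
by move=> /(linear_relationB linT Tlk); rewrite subKr subr0.
Qed.

(** For (l, k) in T with j l in dom T, the pairing of j l with x only sees the
    projection p of x on dom T, where it equals [p, l] = [m, k] for any m with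
    (p, m) in T. So the vectors j l with |k| <= 1 are weakly bounded. *)
Lemma rdom_closed_bound : exists C : R, forall l k,
  T (l, k) -> rdom T (signature K1 l) -> rnorm ip1 l <= C * rnorm ip2 k.
Proof.
pose A := [set y | exists l k,
  [/\ T (l, k), rdom T (signature K1 l), rnorm ip2 k <= 1 & y = signature K1 l]].
have [x|C HC] := @weakly_bounded R K1 ip1 (@hilbert_complete R K1) A.
  have [p [m Tpm] xp] := ortho_projection (@hilbert_complete R K1)
    (linear_rdom linT) cdom x.
  exists (rnorm ip2 m) => _ [l [k [Tlk dl k1 ->]]].
  have -> : ip1 x (signature K1 l) = real_form m k.
    rewrite -(lagrangian_real LT Tpm Tlk) real_form_adj.
    by apply/eqP; rewrite -subr_eq0 -ripBl xp.
  apply: le_trans (real_form_bound _ _) _.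
  by rewrite ler_piMr// rnorm_ge0.
exists C => l k Tlk dl.
have [k0|k0] := leP (rnorm ip2 k) 0.
  (* No rescaling to |k| <= 1 is possible, but then |l|^2 = [j l, l] = [m, k]
   vanishes. *)
  have {}k0 : rnorm ip2 k = 0 by apply/eqP; rewrite eq_le k0 rnorm_ge0.
  have [m Tm] := dl; have := lagrangian_real LT Tm Tlk.
  rewrite real_form_adj -sqr_rnorm rnorm_signature => l2.
  have := real_form_bound m k; rewrite k0 !mulr0 normr_le0 -l2.
  by rewrite sqrf_eq0 => /eqP ->.
have ak : 0 <= (rnorm ip2 k)^-1 by rewrite invr_ge0 ltW.
have : A (signature K1 ((rnorm ip2 k)^-1%:C%C *: l)).
  exists ((rnorm ip2 k)^-1%:C%C *: l), ((rnorm ip2 k)^-1%:C%C *: k); split=> //.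
  - exact: linear_relationZ.
  - by rewrite linearZ; exact: (subspaceZ (linear_rdom linT)).
  - by rewrite rnormZ ger0_norm// mulVf// gt_eqF.
by move=> /HC; rewrite rnorm_signature rnormZ ger0_norm// mulrC ler_pdivrMr.
Qed.

(** After normalization modulo ker T, a convergent sequence of second
    components has a Cauchy, hence convergent, sequence of first components. *)
Lemma seq_closed_rran : seq_closed ip2 (rran T).
Proof.
move=> u k ranu uk.
have /choice[l Hl] : forall n, exists l, T (l, u n) /\ rdom T (signature K1 l).
  by move=> n; have [l /rker_reduction[l' Tl' dl']] := ranu n; exists l'.
have [C HC] := rdom_closed_bound.
have C1 : 0 < `|C| + 1 by rewrite ltr_wpDl.
have [|x lx] := @hilbert_complete R K1 l.
  move=> e e0; have [|N HN] := seq_limit_cauchy uk (e := e / (`|C| + 1)).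
    by rewrite divr_gt0.
  exists N => m n mN nN; have := HN m n mN nN; rewrite ltr_pdivlMr//.
  apply: le_lt_trans; have [Tm dm] := Hl m; have [Tn dn] := Hl n.
  apply: le_trans (HC _ _ (linear_relationB linT Tm Tn) _) _.
    by rewrite linearB; exact: (subspaceB (linear_rdom linT) dm dn).
  rewrite mulrC ler_wpM2l ?rnorm_ge0//.
  by rewrite (le_trans (ler_norm _))// lerDl.
exists x; apply: (lagrangian_seq_closed _ (seq_limit_pair lx uk)) => n.
by have [] := Hl n.
Qed.

End Lagrangian.

(** * Products of Lagrangian relations *)

(** The composition principle: k is first lifted through S, and the lift is then
    corrected by an element of ker S. *)
Lemma lagrangian_rprod {K1 K2 K3} (S : set (K2 * K3)) (T : set (K1 * K2)) :
  linear_relation S -> linear_relation T -> lagrangian S -> lagrangian T ->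
  seq_closed (hilbert_inner K2) (rdom S) ->
  seq_closed (prod_inner (hilbert_inner K1) (hilbert_inner K2))
    (rsum T ([set 0] `*` rker S)) ->
  lagrangian (rprod S T).
Proof.
move=> linS linT LS LT cdom csum h k; split.
  move=> [g Thg Sgk] f f' [g' Tfg' Sgf'].
  by rewrite (lagrangian_real LT Thg Tfg') (lagrangian_real LS Sgk Sgf').
move=> H.
(* [k, m] = 0 for m in mul S, because (0, m) is in ST. *)
have [l0 Sl0k] : rran S k.
  apply: (rdom_perp_rker (linear_rinv linS) (lagrangian_inv LS)).
    exact: seq_closed_rran.
  move=> m Sm; have := H 0 m; rewrite !(real_formC _ 0) !real_form0 real_formC.
  by move=> <-//; exists 0 => //; exact: (subspace0 linT).
have linN : linear_relation ([set 0] `*` rker S : set (K1 * K2)).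
  apply: linear_relationI; first by split=> //; exact: linear_relation0.
  move=> a f g f' g' [/= -> Sg] [/= -> Sg']; split; first by rewrite /= scaler0 addr0.
  by have := linear_relationP a linS Sg Sg'; rewrite scaler0 addr0.
have : rsum T ([set 0] `*` rker S) (h, l0).
  apply: (ortho_ortho _ (linear_rsum linT linN) csum) => //.
    exact: seq_complete_prod (@hilbert_complete R K1) (@hilbert_complete R K2).
  move=> [a b] Hab.
  (* (f, g) turns the Hilbert space pairing with (a, b) into the form on graphs,
     so it is in the companion of the sum. *)
  pose f := signature K1 a; pose g := - signature K2 b.
  have Hsum x y : rsum T ([set 0] `*` rker S) (x, y) ->
      real_form f x = real_form g y.
    move=> /Hab /= /eqP; rewrite -[_ + _]/(hilbert_inner K1 a x + hilbert_inner K2 b y).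
    rewrite addr_eq0 => /eqP abxy; rewrite /real_form signatureV abxy.
    by rewrite /g linearN signatureV ripNl.
  have Tfg : T (f, g).
    apply/LT => x y Txy; apply: Hsum; exists (x, y) => //; exists 0; last by rewrite addr0.
    exact: (subspace0 linN).
  have [m Sgm] : rdom S g.
    apply: (rdom_perp_rker linS LS cdom) => x Sx.
    rewrite real_formC -(Hsum 0 x); first by rewrite real_formC real_form0.
    exists 0; first exact: (subspace0 linT).
    by exists (0, x) => //; rewrite add0r.
  have := H f m (ex_intro2 _ _ g Tfg Sgm).
  rewrite -(lagrangian_real LS Sl0k Sgm) /f /g real_form_signature.
  rewrite real_form_adj linearN signatureV ripNr => hf.
  rewrite -[LHS]/(hilbert_inner K1 h a + hilbert_inner K2 l0 b).
  by rewrite hf addNr.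
move=> [[x y] Txy [[z w] [/= z0 Sw] [xzh ywl]]].
exists y; first by rewrite -xzh z0 addr0.
rewrite -[y](addrK w) ywl -[k]subr0.
exact: linear_relationB.
Qed.

Lemma rsum_zero {K1 K2} (T N : set (K1 * K2)) :
  linear_relation T -> N (0, 0) -> N `<=` T -> rsum T N = T.
Proof.
move=> linT N0 NT; apply/seteqP; split=> [_ [x Tx [y /NT Ty <-]]|x Tx].
  exact: (subspaceD linT).
by exists x => //; exists 0 => //; rewrite addr0.
Qed.

(** Taking orthogonal companions turns ran T <= dom S into ker S <= mul T, so
    that the componentwise sum in [lagrangian_rprod] is T. *)
Lemma lagrangian_rprod_ran_dom {K1 K2 K3} (S : set (K2 * K3)) (T : set (K1 * K2)) :
  linear_relation S -> linear_relation T -> lagrangian S -> lagrangian T ->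
  rran T `<=` rdom S -> seq_closed (hilbert_inner K2) (rdom S) ->
  lagrangian (rprod S T) /\ rdom (rprod S T) = rdom T.
Proof.
move=> linS linT LS LT TS cdom; split; last first.
  apply/seteqP; split=> f; first by move=> [h [g Tfg _]]; exists g.
  move=> [g Tfg]; have [|h Sgh] := TS g; first by exists f.
  by exists h, g.
apply: lagrangian_rprod => //; rewrite rsum_zero//.
- exact: lagrangian_seq_closed.
- by split=> //; exact: linear_relation0.
move=> [_ w] [/= -> Sw]; apply/LT => f g Tfg.
rewrite real_form0 ((rker_perp LS w).1 Sw)//; apply: TS; by exists f.
Qed.

Lemma seq_closed_rinv {K1 K2} (M : set (K1 * K2)) :
  seq_closed (prod_inner (hilbert_inner K1) (hilbert_inner K2)) M ->
  seq_closed (prod_inner (hilbert_inner K2) (hilbert_inner K1)) (rinv M).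
Proof.
move=> cM u [k h] Mu ul.
exact: (cM _ _ Mu (seq_limit_pair (seq_limit_snd ul) (seq_limit_fst ul))).
Qed.

Lemma rinv_rsum {K1 K2} (T1 T2 : set (K1 * K2)) :
  rinv (rsum T1 T2) = rsum (rinv T1) (rinv T2).
Proof.
apply/seteqP; split=> -[k h].
  by move=> [[f g] T1fg [[f' g'] T2fg [<- <-]]]; exists (g, f) => //; exists (g', f').
by move=> [[g f] T1fg [[g' f'] T2fg [<- <-]]]; exists (f, g) => //; exists (f', g').
Qed.

(** [lagrangian_rprod] for the inverse relations. *)
Lemma lagrangian_rprod_inv {K1 K2 K3} (S : set (K2 * K3)) (T : set (K1 * K2)) :
  linear_relation S -> linear_relation T -> lagrangian S -> lagrangian T ->
  seq_closed (hilbert_inner K2) (rran T) ->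
  seq_closed (prod_inner (hilbert_inner K2) (hilbert_inner K3))
    (rsum S (rmul T `*` [set 0])) ->
  lagrangian (rprod S T).
Proof.
move=> linS linT LS LT cran csum.
apply: (lagrangian_inv (T := rinv (rprod S T))); rewrite rinv_rprod.
apply: lagrangian_rprod; do ?[exact: linear_rinv|exact: lagrangian_inv|by []].
have := seq_closed_rinv csum; rewrite rinv_rsum; congr (seq_closed _ (rsum _ _)).
by apply/seteqP; split=> -[k g] [? ?].
Qed.

(** The multivalued part is the orthogonal companion of the range. *)
Lemma single_valued_of_full_range {K1 K2} (T : set (K1 * K2)) :
  linear_relation T -> lagrangian T -> rran T = setT -> single_valued T.
Proof.
move=> linT LT ranT; apply/seteqP; split=> [k Tk|_ ->]; last exact: linear_relation0.
apply: (@rip_eq0 _ _ (hilbert_inner K2)); rewrite -real_form_signature.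
apply: (rker_perp (lagrangian_inv LT) k).1 => //.
by have : rran T (signature K2 k) by rewrite ranT.
Qed.

(** [rdom_closed_bound] for the inverse, whose domain is the whole space. *)
Lemma bounded_of_full_range {K1 K2} (T : set (K1 * K2)) :
  linear_relation T -> lagrangian T -> rran T = setT -> bounded_relation T.
Proof.
move=> linT LT ranT.
have ran k : rdom (rinv T) k by have : rran T k by rewrite ranT.
have [|C HC] := rdom_closed_bound (linear_rinv linT) (lagrangian_inv LT).
  by move=> *; exact: ran.
exists C => f g Tfg; rewrite !normE -rmorphM /= lecR.
by apply: HC => //; exact: ran.
Qed.

End Relations.

Theorem theorem2p13 (R : realType) (K1 K2 K3 : kreinSpace R)
    (T : set (K1 * K2)) (S : set (K2 * K3))
    (linT : linear_relation T) (linS : linear_relation S)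
    (isoT : isometric T) (isoS : isometric S) :
  (* (i) *)
  (linear_relation (rprod S T) /\ isometric (rprod S T)) /\
  (unitary T -> unitary S ->
    (* (ii) *)
    (closed (rdom S) -> closed (rsum T ([set 0] `*` rker S)) ->
       unitary (rprod S T)) /\
    (* (iii) *)
    (rran T `<=` rdom S -> closed (rdom S) ->
       unitary (rprod S T) /\ rdom (rprod S T) = rdom T) /\
    (* (iv) *)
    (closed (rdom T) -> closed (rsum S (rmul T `*` [set 0])) ->
       unitary (rprod S T)) /\
    (* (v) *)
    (rdom S `<=` rran T -> closed (rdom T) ->
       unitary (rprod S T) /\ rran (rprod S T) = rran S) /\
    (* (vi) *)
    (rran T = rdom S -> rran S = [set: K3] ->
       [/\ unitary (rprod S T), bounded_relation (rprod S T)
         & single_valued (rprod S T)]) /\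
    (* (vii) *)
    (bounded_operators K1 K2 T \/ bounded_operators K2 K3 S ->
       unitary (rprod S T)) /\
    (* (viii) *)
    (bounded_operators K1 K2 T -> bounded_operators K2 K3 S ->
       [/\ unitary (rprod S T), single_valued (rprod S T)
         & bounded_operators K1 K3 (rprod S T)])).
Proof.
have linST := linear_rprod linS linT.
split; first by split=> //; exact: isometric_rprod.
move=> /(unitaryE linT) LT /(unitaryE linS) LS.
have uST : unitary (rprod S T) <-> lagrangian (rprod S T) := unitaryE linST.
have ran_closed : closed (rdom T) -> seq_closed (hilbert_inner K2) (rran T).
  by move=> /closed_seq_closed; exact: seq_closed_rran.
have of_ran_dom : rran T `<=` rdom S -> seq_closed (hilbert_inner K2) (rdom S) ->
    unitary (rprod S T) /\ rdom (rprod S T) = rdom T.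
  by move=> TS cS; rewrite uST; exact: lagrangian_rprod_ran_dom.
have of_closed_dom : closed (rdom T) ->
    seq_closed (prod_inner (hilbert_inner K2) (hilbert_inner K3))
      (rsum S (rmul T `*` [set 0])) -> unitary (rprod S T).
  by move=> cT cS; apply/uST/lagrangian_rprod_inv => //; exact: ran_closed.
have of_bounded : bounded_operators K1 K2 T \/ bounded_operators K2 K3 S ->
    unitary (rprod S T).
  case=> -[[A TA] _].
    apply: of_closed_dom.
      rewrite (_ : rdom T = setT)//; apply/seteqP; split=> // f _.
      by exists (A f); rewrite TA.
    rewrite rsum_zero//; first exact: lagrangian_seq_closed.
      by split=> //; exact: linear_relation0.
    move=> [g h] [/= Tg ->]; move: Tg; rewrite /rmul TA /= linear0 => ->.
    exact: linear_relation0.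
  have domS g : rdom S g by exists (A g); rewrite TA.
  by apply: (proj1 (of_ran_dom _ _)) => // *; exact: domS.
split; [|split; [|split; [|split; [|split; [|split; [exact: of_bounded|]]]]]].
- move=> /closed_seq_closed cS /closed_seq_closed2 cTS.
  exact/uST/lagrangian_rprod.
- by move=> TS /closed_seq_closed; exact: of_ran_dom.
- by move=> cT /closed_seq_closed2; exact: of_closed_dom.
- move=> ST cT; rewrite uST.
  have [] := lagrangian_rprod_ran_dom (linear_rinv linT) (linear_rinv linS)
    (lagrangian_inv LT) (lagrangian_inv LS) ST (ran_closed cT).
  rewrite -rinv_rprod => LST domST.
  by split; [exact: (lagrangian_inv LST)|exact: domST].
- move=> TS ranS.
  have [||uP _] := of_ran_dom; first by rewrite TS.
    apply: (seq_closed_rran (linear_rinv linS) (lagrangian_inv LS)).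
    by rewrite -[rdom _]/(rran S) ranS.
  have ranST : rran (rprod S T) = setT.
    apply/seteqP; split=> // h _; have [g Sgh] : rran S h by rewrite ranS.
    have [f Tfg] : rran T g by rewrite TS; exists h.
    by exists f, g.
  have LST := uST.1 uP; split=> //.
    exact: bounded_of_full_range.
  exact: single_valued_of_full_range.
move=> bT bS; split; first by apply: of_bounded; left.
  have [[A TA] _] := bT; have [[B SB] _] := bS.
  apply/seteqP; split=> [h [g]|_ ->]; last exact: linear_relation0.
  by rewrite TA SB /= linear0 => -> ->; rewrite linear0.
have [[A TA] [M HM]] := bT; have [[B SB] [N HN]] := bS; split.
  exists (B \o A : {linear K1 -> K3}); apply/seteqP; split=> -[f h] /=.
    by move=> [g]; rewrite TA SB /= => -> ->.
  by move=> ->; exists (A f); rewrite ?TA ?SB.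
exists (`|N| * M) => f h [g Tfg Sgh].
have /= := HN _ _ Sgh; have := HM _ _ Tfg; rewrite !normE -!rmorphM /= !lecR => gf hg.
apply: le_trans hg _; rewrite -mulrA.
apply: (@le_trans _ _ (`|N| * rnorm (hilbert_inner K2) g)).
  by rewrite ler_wpM2r ?rnorm_ge0 ?ler_norm.
by rewrite ler_wpM2l.
Qed.
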